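(* Let $\Sigma: x^+=Ax+Bu+Ew$ be a discrete-time linear system with $A$ nilpotent of nilpotency index $\nu$, and let the safe set $S_{xu}\subset\mathbb{R}^n\times\mathbb{R}^m$ and the disturbance set $W\subset\mathbb{R}^d$ be polytopes. Let $q\in\mathbb{N}$, let $P\in\mathbb{R}^{mq\times mq}$ be an eventually periodic matrix with transient $\tau\in\mathbb{N}\cup\{0\}$ and period $\lambda\in\mathbb{N}$, and let $H\in\mathbb{R}^{m\times mq}$ be surjective. Let $\mathcal{C}_{xv}\subset\mathbb{R}^n\times\mathbb{R}^{mq}$ be the set of all $(x,v)$ satisfying the finitely many constraints $$\Big(A^t x+\sum_{i=1}^{t}A^{i-1}BHP^{t-i}v,\ HP^tv\Big)\in S_{xu}-\overline{W}_t\times\{0\},\qquad t=0,\dots,\nu-1,$$ $$\Big(\sum_{i=1}^{\nu}A^{i-1}BHP^{t-i}v,\ HP^tv\Big)\in S_{xu}-\overline{W}_\infty\times\{0\},\qquad t=\nu,\dots,\nu+\tau+\lambda-1.$$ Then $\mathcal{C}_{xv}$ is an implicit RCIS for $\Sigma$ within $S_{xu}$. Moreover, $\mathcal{C}_{xv}$ is the Maximal RPIS of the companion system $\Sigma_{xv}$ within the companion safe set $S_{xv}$.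
   Context: Setting: $x\in\mathbb{R}^n$ is the state, $u\in\mathbb{R}^m$ the input, $w\in W\subset\mathbb{R}^d$ the disturbance; $A\in\mathbb{R}^{n\times n}$, $B\in\mathbb{R}^{n\times m}$, $E\in\mathbb{R}^{n\times d}$. $\mathbb{N}$ denotes the positive integers. The nilpotency index $\nu\in\mathbb{N}$ is the smallest positive integer with $A^\nu=0$. A polytope is a bounded set of the form $\{z\mid Gz\le f\}$. Sets: the sum of sets is the Minkowski sum; the Minkowski difference is $Q-P=\{z\mid z+p\in Q\ \forall p\in P\}$. The accumulated disturbance sets are $\overline{W}_t=\sum_{i=1}^tA^{i-1}EW$ (with $\overline{W}_0=\{0\}$) and $\overline{W}_\infty=\sum_{i=1}^{\nu}A^{i-1}EW$. $\pi_n$ denotes the projection onto the first $n$ coordinates. RCIS: $\mathcal{C}\subseteq\pi_n(S_{xu})$ is a robust controlled invariant set (RCIS) for $\Sigma$ within $S_{xu}$ if for every $x\in\mathcal{C}$ there is $u\in\mathbb{R}^m$ with $(x,u)\in S_{xu}$ and $Ax+Bu+EW\subseteq\mathcal{C}$. Implicit RCIS: a set $\mathcal{C}_{xv}\subseteq\mathbb{R}^n\times\mathbb{R}^{p}$ (for some $p\in\mathbb{N}$) is an implicit RCIS for $\Sigma$ within $S_{xu}$ if $\pi_n(\mathcal{C}_{xv})$ is an RCIS for $\Sigma$ within $S_{xu}$. RPIS: for a system $z^+=Fz+Gw$, $w\in W$, a set $\mathcal{C}\subseteq S$ is a robust positively invariant set (RPIS) within $S$ if $z\in\mathcal{C}$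 implies $Fz+Gw\in\mathcal{C}$ for all $w\in W$. The Maximal RPIS within $S$ is the one containing every other RPIS within $S$. Companion system: given $P,H$, $\Sigma_{xv}$ is $$\begin{bmatrix}x^+ \\ v^+\end{bmatrix}=\begin{bmatrix}A&BH \\ 0&P\end{bmatrix}\begin{bmatrix}x \\ v\end{bmatrix}+\begin{bmatrix}E \\ 0\end{bmatrix}w,\quad w\in W,$$ and the companion safe set is $S_{xv}=\{(x,v)\in\mathbb{R}^n\times\mathbb{R}^{mq}\mid(x,Hv)\in S_{xu}\}$. Eventually periodic matrix: $P$ is eventually periodic with transient $\tau$ and period $\lambda$ if $P^{t+\lambda}=P^t$ for all $t\ge\tau$. *)

(* Defs.v *)
From mathcomp Require Import all_boot all_order all_algebra.
From mathcomp Require Import all_classical all_reals all_analysis.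

Set Implicit Arguments.
Unset Strict Implicit.
Unset Printing Implicit Defensive.

Import Order.TTheory GRing.Theory Num.Theory.
Import numFieldNormedType.Exports.

Local Open Scope ring_scope.
Local Open Scope classical_set_scope.

(* Points of R^n are column vectors 'cV[R]_n, and a pair (x, u) of R^n x R^m
   is the stacked vector col_mx x u : 'cV[R]_(n + m). *)

Section Sets.
Context {R : realType}.

Definition polytope k (Q : set 'cV[R]_k) : Prop :=
  bounded_set Q /\
  exists (l : nat) (G : 'M[R]_(l, k)) (f : 'cV[R]_l),
    Q = [set z | forall i, (G *m z) i 0 <= f i 0].

Definition minkowski_sum k (Q P : set 'cV[R]_k) : set 'cV[R]_k :=
  [set z + p | z in Q & p in P].

Definition minkowski_diff k (Q P : set 'cV[R]_k) : set 'cV[R]_k :=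
  [set z | forall p, P p -> Q (z + p)].

Definition mx_image k l (M : 'M[R]_(l, k)) (Q : set 'cV[R]_k) : set 'cV[R]_l :=
  [set M *m z | z in Q].

Definition stacked_product k l (Q : set 'cV[R]_k) (P : set 'cV[R]_l) :
    set 'cV[R]_(k + l) :=
  [set col_mx z p | z in Q & p in P].

Definition proj_first n p (C : set 'cV[R]_(n + p)) : set 'cV[R]_n :=
  [set usubmx z | z in C].

End Sets.

Section Matrices.
Context {R : realType}.

Definition nilpotency_index n (A : 'M[R]_n) (nu : nat) : Prop :=
  [/\ (0 < nu)%N, A ^+ nu = 0 &
      forall k : nat, (0 < k)%N -> A ^+ k = 0 -> (nu <= k)%N].

Definition eventually_periodic k (P : 'M[R]_k) (tau lambda : nat) : Prop :=
  forall t : nat, (tau <= t)%N -> P ^+ (t + lambda) = P ^+ t.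

Definition surjective_mx k l (H : 'M[R]_(l, k)) : Prop :=
  set_surj [set: 'cV[R]_k] [set: 'cV[R]_l] (mulmx H).

End Matrices.

Section Invariance.
Context {R : realType}.

Definition is_RCIS n m d (A : 'M[R]_n) (B : 'M[R]_(n, m)) (E : 'M[R]_(n, d))
    (W : set 'cV[R]_d) (Sxu : set 'cV[R]_(n + m)) (C : set 'cV[R]_n) : Prop :=
  C `<=` proj_first Sxu /\
  forall x, C x -> exists u : 'cV[R]_m,
    Sxu (col_mx x u) /\
    minkowski_sum [set A *m x + B *m u] (mx_image E W) `<=` C.

Definition is_implicit_RCIS n m d (A : 'M[R]_n) (B : 'M[R]_(n, m))
    (E : 'M[R]_(n, d)) (W : set 'cV[R]_d) (Sxu : set 'cV[R]_(n + m))
    p (Cxv : set 'cV[R]_(n + p)) : Prop :=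
  is_RCIS A B E W Sxu (proj_first Cxv).

Definition is_RPIS k d (F : 'M[R]_k) (G : 'M[R]_(k, d)) (W : set 'cV[R]_d)
    (S C : set 'cV[R]_k) : Prop :=
  C `<=` S /\ forall z, C z -> forall w, W w -> C (F *m z + G *m w).

Definition is_maximal_RPIS k d (F : 'M[R]_k) (G : 'M[R]_(k, d))
    (W : set 'cV[R]_d) (S C : set 'cV[R]_k) : Prop :=
  is_RPIS F G W S C /\ forall C', is_RPIS F G W S C' -> C' `<=` C.

End Invariance.

Section Companion.
Context {R : realType}.

(* \overline{W}_t; the empty Minkowski sum (t = 0) is {0}. *)
Definition acc_disturbance n d (A : 'M[R]_n) (E : 'M[R]_(n, d))
    (W : set 'cV[R]_d) (t : nat) : set 'cV[R]_n :=
  \big[@minkowski_sum R n/[set 0]]_(1 <= i < t.+1)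
    mx_image (A ^+ i.-1 *m E) W.

(* \overline{W}_\infty, for A of nilpotency index nu. *)
Definition acc_disturbance_inf n d (A : 'M[R]_n) (E : 'M[R]_(n, d))
    (W : set 'cV[R]_d) (nu : nat) : set 'cV[R]_n :=
  acc_disturbance A E W nu.

Definition companion_mx n m k (A : 'M[R]_n) (B : 'M[R]_(n, m))
    (P : 'M[R]_k) (H : 'M[R]_(m, k)) : 'M[R]_(n + k) :=
  block_mx A (B *m H) 0 P.

Definition companion_dist_mx n d k (E : 'M[R]_(n, d)) : 'M[R]_(n + k, d) :=
  col_mx E 0.

Definition companion_safe_set n m k (H : 'M[R]_(m, k))
    (Sxu : set 'cV[R]_(n + m)) : set 'cV[R]_(n + k) :=
  [set z | Sxu (col_mx (usubmx z) (H *m dsubmx z))].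

(* The exponents t - i are truncated subtractions on nat, but i <= t throughout
   both sums. *)
Definition Cxv n m d k (A : 'M[R]_n) (B : 'M[R]_(n, m)) (E : 'M[R]_(n, d))
    (W : set 'cV[R]_d) (Sxu : set 'cV[R]_(n + m))
    (P : 'M[R]_k) (H : 'M[R]_(m, k)) (nu tau lambda : nat) :
    set 'cV[R]_(n + k) :=
  [set z | let x := usubmx z in let v := dsubmx z in
    (forall t : nat, (t < nu)%N ->
       minkowski_diff Sxu
         (stacked_product (acc_disturbance A E W t) [set 0])
         (col_mx
            (A ^+ t *m x +
             \sum_(1 <= i < t.+1) A ^+ i.-1 *m B *m H *m P ^+ (t - i) *m v)
            (H *m P ^+ t *m v))) /\
    (forall t : nat, (nu <= t)%N -> (t < nu + tau + lambda)%N ->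
       minkowski_diff Sxu
         (stacked_product (acc_disturbance_inf A E W nu) [set 0])
         (col_mx
            (\sum_(1 <= i < nu.+1) A ^+ i.-1 *m B *m H *m P ^+ (t - i) *m v)
            (H *m P ^+ t *m v)))].

End Companion.

(* Main.v *)
Require Import Defs.
From HB Require Import structures.
From mathcomp Require Import all_boot all_order all_algebra.
From mathcomp Require Import all_classical all_reals all_analysis.

(** For any linear system [z^+ = F z + G w], the largest robustly invariant
    subset of a safe set consists of the states whose reachable sets
    [F ^+ t *m z + acc_disturbance F G W t] are safe at all times [t]
    ([robustly_safe_states_maximal]).  For the companion system the block
    triangular shape of [F] makes these reachable sets explicit
    ([companion_iterE], [companion_acc_disturbance]), so that the maximal set is
    cut out by one constraint [safe_after t] for each time [t].

    Infinitely many of these constraints repeat earlier ones.  As [A ^+ nu = 0],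
    for [t >= nu] the constraint no longer involves the initial state, and
    involves only the [nu] latest inputs and disturbances
    ([safe_after_nilpotent]); the inputs enter through [P ^+ (t - nu)], ...,
    [P ^+ t], which are periodic in [t] from [nu + tau] on
    ([safe_after_periodic]).  The times [t < nu + tau + lambda] thus imply all
    the others, and they give exactly the set [Cxv].

    Finally, an invariant set of the companion system projects onto a robust
    controlled invariant set, because the input [u = H v] realizes the first
    component of the companion dynamics ([companion_RPIS_implicit_RCIS]). *)

Set Implicit Arguments.
Unset Strict Implicit.
Unset Printing Implicit Defensive.

Import Order.TTheory GRing.Theory Num.Theory.
Import numFieldNormedType.Exports.

Local Open Scope ring_scope.
Local Open Scope classical_set_scope.

(** * Minkowski sums and accumulated disturbances *)

Section MinkowskiSum.
Context {R : realType}.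

Lemma minkowski_sumA k : associative (@minkowski_sum R k).
Proof.
move=> X Y Z; apply/seteqP; split => z.
- case=> x Xx [_ [y Yy [w Zw <-]] <-].
  by exists (x + y); [exists x => //; exists y | exists w; rewrite ?addrA].
- case=> _ [x Xx [y Yy <-]] [w Zw <-].
  by exists x => //; exists (y + w); [exists y => //; exists w | rewrite addrA].
Qed.

Lemma minkowski_sumC k : commutative (@minkowski_sum R k).
Proof.
move=> X Y; apply/seteqP; split => z [x Xx [y Yy <-]];
  by exists y => //; exists x => //; rewrite addrC.
Qed.

Lemma minkowski_sum0 k : left_id [set 0] (@minkowski_sum R k).
Proof.
move=> X; apply/seteqP; split => z.
- by case=> _ -> [x Xx <-]; rewrite add0r.
- by move=> Xz; exists 0 => //; exists z; rewrite ?add0r.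
Qed.

HB.instance Definition _ k := Monoid.isComLaw.Build (set 'cV[R]_k) [set 0]
  (@minkowski_sum R k) (@minkowski_sumA k) (@minkowski_sumC k)
  (@minkowski_sum0 k).

Lemma mx_image_sum k l (M : 'M[R]_(l, k)) :
  {morph mx_image M : X Y / minkowski_sum X Y}.
Proof.
move=> X Y; apply/seteqP; split => z.
- case=> _ [x Xx [y Yy <-]] <-.
  exists (M *m x); first by exists x.
  by exists (M *m y); [exists y | rewrite mulmxDr].
- case=> _ [x Xx <-] [_ [y Yy <-] <-].
  by exists (x + y); [exists x => //; exists y | rewrite mulmxDr].
Qed.

Lemma mx_image_set0 k l (M : 'M[R]_(l, k)) : mx_image M [set 0] = [set 0].
Proof. by rewrite /mx_image image_set1 mulmx0. Qed.

Lemma mx_image_mul k l h (M : 'M[R]_(h, l)) (N : 'M[R]_(l, k)) X :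
  mx_image (M *m N) X = mx_image M (mx_image N X).
Proof.
apply/seteqP; split => z.
- by case=> x Xx <-; exists (N *m x); [exists x | rewrite mulmxA].
- by case=> _ [x Xx <-] <-; exists x; rewrite ?mulmxA.
Qed.

Lemma mx_image_zero k l (X : set 'cV[R]_k) :
  X !=set0 -> mx_image (0 : 'M[R]_(l, k)) X = [set 0].
Proof.
move=> [x Xx]; apply/seteqP; split => z; first by case=> y _ <-; rewrite mul0mx.
by move=> ->; exists x; rewrite ?mul0mx.
Qed.

End MinkowskiSum.

Section DisturbanceSum.
Context {R : realType}.
Variables (n d : nat) (A : 'M[R]_n) (E : 'M[R]_(n, d)) (W : set 'cV[R]_d).

Lemma acc_disturbance0 : acc_disturbance A E W 0 = [set 0].
Proof. by rewrite /acc_disturbance big_geq. Qed.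

Lemma acc_disturbanceSr t :
  acc_disturbance A E W t.+1 =
  minkowski_sum (acc_disturbance A E W t) (mx_image (A ^+ t *m E) W).
Proof. by rewrite /acc_disturbance big_nat_recr. Qed.

(** A matrix intertwining two dynamics, [F *m J = J *m A], intertwines all their
    powers, hence carries the disturbances accumulated by one system to those
    accumulated by the other.  This serves twice: with [J] the inclusion of the
    state space into the companion state space, and with [J = F = A]. *)
Lemma acc_disturbance_intertwine k (F : 'M[R]_k) (J : 'M[R]_(k, n)) t :
  F *m J = J *m A ->
  acc_disturbance F (J *m E) W t = mx_image J (acc_disturbance A E W t).
Proof.
move=> FJ.
have FJX i : F ^+ i *m J = J *m A ^+ i.
  elim: i => [|i IHi]; first by rewrite !expr0 mul1mx mulmx1.
  by rewrite !exprS -!mulmxE -mulmxA IHi !mulmxA FJ.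
rewrite /acc_disturbance (big_morph _ (mx_image_sum J) (mx_image_set0 J)).
by apply: eq_bigr => i _; rewrite mulmxA FJX -mulmxA mx_image_mul.
Qed.

End DisturbanceSum.

Section DisturbanceSumTheory.
Context {R : realType}.
Variables (n d : nat) (A : 'M[R]_n) (E : 'M[R]_(n, d)) (W : set 'cV[R]_d).

Lemma acc_disturbanceSl t :
  acc_disturbance A E W t.+1 =
  minkowski_sum (mx_image E W) (mx_image A (acc_disturbance A E W t)).
Proof.
rewrite -(acc_disturbance_intertwine E W t (erefl (A *m A))).
rewrite /acc_disturbance big_nat_recl // expr0 mul1mx; congr minkowski_sum.
apply: eq_big_nat => -[//|i] _ /=.
by rewrite exprSr -mulmxE mulmxA.
Qed.

(** From the nilpotency index on, each new term of the sum is the image of [W]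
    under the zero matrix.  For empty [W] that image is empty instead of the
    neutral set [{0}]; the sum is then empty as soon as it has one term, so the
    equality survives because [nu] is positive. *)
Lemma acc_disturbance_nilpotent nu t :
  (0 < nu)%N -> A ^+ nu = 0 -> (nu <= t)%N ->
  acc_disturbance A E W t = acc_disturbance A E W nu.
Proof.
move=> nu0 Anu; have [->|W0] := eqVneq W set0.
  have emp s : (0 < s)%N -> acc_disturbance A E set0 s = set0.
    case: s => // s _; rewrite acc_disturbanceSr /mx_image image_set0.
    by apply/seteqP; split => z // [? _ []].
  by move=> nut; rewrite !emp // (leq_trans nu0).
move/subnKC => <-; elim: (t - nu)%N => [|s IHs]; first by rewrite addn0.
rewrite addnS acc_disturbanceSr IHs exprD Anu mul0r mul0mx.
rewrite mx_image_zero; last exact/set0P.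
by rewrite minkowski_sumC minkowski_sum0.
Qed.

End DisturbanceSumTheory.

(** * The maximal robust positively invariant set of a linear system *)

Section MaximalRPIS.
Context {R : realType}.
Variables (k d : nat) (F : 'M[R]_k) (G : 'M[R]_(k, d)).
Variables (W : set 'cV[R]_d) (S : set 'cV[R]_k).

Definition robustly_safe_states : set 'cV[R]_k :=
  [set z | forall t p, acc_disturbance F G W t p -> S (F ^+ t *m z + p)].

(** The points [F ^+ t *m z + p], with [p] an accumulated disturbance, are
    exactly the states reachable from [z] in [t] steps.  An invariant set
    contains them all (peel off the last step), and demanding that they be safe
    is itself an invariant condition (peel off the first step). *)
Lemma robustly_safe_states_maximal :
  is_maximal_RPIS F G W S robustly_safe_states.
Proof.
split.
  split=> [z safe_z|z safe_z w Ww t p tp].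
    have := safe_z 0 0; rewrite acc_disturbance0 expr0 mul1mx addr0.
    by apply.
  have -> : F ^+ t *m (F *m z + G *m w) + p =
            F ^+ t.+1 *m z + (p + F ^+ t *m G *m w).
    by rewrite exprSr -mulmxE mulmxDr !mulmxA -addrA [p + _]addrC.
  apply: safe_z; rewrite acc_disturbanceSr.
  by exists p => //; exists (F ^+ t *m G *m w) => //; exists w.
move=> C [CS Cinv] z Cz t p tp; apply: CS.
elim: t p tp => [|t IHt] p.
  by rewrite acc_disturbance0 => ->; rewrite expr0 mul1mx addr0.
rewrite acc_disturbanceSl => -[_ [w Ww <-] [_ [r tr <-] <-]].
have -> : F ^+ t.+1 *m z + (G *m w + F *m r) =
          F *m (F ^+ t *m z + r) + G *m w.
  by rewrite exprS -mulmxE mulmxDr !mulmxA -addrA [F *m r + _]addrC.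
exact/Cinv/Ww/IHt.
Qed.

End MaximalRPIS.

(** * The companion system *)

Section CompanionSystem.
Context {R : realType}.
Variables (n m d k : nat) (A : 'M[R]_n) (B : 'M[R]_(n, m)) (E : 'M[R]_(n, d)).
Variables (P : 'M[R]_k) (H : 'M[R]_(m, k)).
Variables (W : set 'cV[R]_d) (Sxu : set 'cV[R]_(n + m)).

Let F := companion_mx A B P H.
Let G := companion_dist_mx k E.
Let Sxv := companion_safe_set H Sxu.
Let state_incl : 'M[R]_(n + k, n) := col_mx 1%:M 0.

Lemma companion_stepE (z : 'cV[R]_(n + k)) w :
  F *m z + G *m w =
  col_mx (A *m usubmx z + B *m H *m dsubmx z + E *m w) (P *m dsubmx z).
Proof.
rewrite -{1}[z]vsubmxK /F /companion_mx mul_block_col mul_col_mx.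
by rewrite !mul0mx add_col_mx add0r addr0.
Qed.

Lemma companion_iterE t (x : 'cV[R]_n) (v : 'cV[R]_k) :
  F ^+ t *m col_mx x v =
  col_mx (A ^+ t *m x +
          \sum_(1 <= i < t.+1) A ^+ i.-1 *m B *m H *m P ^+ (t - i) *m v)
         (P ^+ t *m v).
Proof.
elim: t => [|t IHt]; first by rewrite big_geq // !expr0 !mul1mx addr0.
rewrite exprS -mulmxE -mulmxA IHt mul_block_col mul0mx add0r.
rewrite !exprS -!mulmxE -!mulmxA; congr col_mx.
rewrite mulmxDr -addrA; congr (_ + _).
rewrite [RHS]big_nat_recl //= expr0 mul1mx subn1 addrC; congr (_ + _);
  first by rewrite !mulmxA.
rewrite mulmx_sumr; apply: eq_big_nat => -[//|i] _ /=.
by rewrite subSS exprS -mulmxE !mulmxA.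
Qed.

Lemma companion_acc_disturbance t :
  acc_disturbance F G W t = mx_image state_incl (acc_disturbance A E W t).
Proof.
have FJ : F *m state_incl = state_incl *m A.
  rewrite /state_incl mul_block_col mul_col_mx !mul0mx !mulmx0.
  by rewrite mulmx1 mul1mx !addr0.
have -> : G = state_incl *m E by rewrite /state_incl mul_col_mx mul1mx mul0mx.
exact: acc_disturbance_intertwine.
Qed.

(** The constraint on the [t]-step reachable states, before any use of
    nilpotency or periodicity. *)
Definition safe_after t (x : 'cV[R]_n) (v : 'cV[R]_k) : Prop :=
  minkowski_diff Sxu (stacked_product (acc_disturbance A E W t) [set 0])
    (col_mx (A ^+ t *m x +
             \sum_(1 <= i < t.+1) A ^+ i.-1 *m B *m H *m P ^+ (t - i) *m v)
            (H *m P ^+ t *m v)).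

Lemma robustly_safe_companionE z :
  robustly_safe_states F G W Sxv z <->
  forall t, safe_after t (usubmx z) (dsubmx z).
Proof.
have iterE t (p : 'cV_n) : F ^+ t *m z + state_incl *m p =
    col_mx (A ^+ t *m usubmx z + \sum_(1 <= i < t.+1)
              A ^+ i.-1 *m B *m H *m P ^+ (t - i) *m dsubmx z + p)
           (P ^+ t *m dsubmx z).
  rewrite -{1}[z]vsubmxK companion_iterE /state_incl mul_col_mx mul1mx mul0mx.
  by rewrite add_col_mx addr0.
split=> safe_z t.
- move=> _ [p tp [_ -> <-]]; rewrite add_col_mx addr0.
  have := safe_z t (state_incl *m p); rewrite companion_acc_disturbance.
  rewrite iterE /Sxv /companion_safe_set /= col_mxKu col_mxKd mulmxA.
  by apply; exists p.
- rewrite companion_acc_disturbance => _ [p tp <-].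
  rewrite iterE /Sxv /companion_safe_set /= col_mxKu col_mxKd mulmxA.
  have := safe_z t (col_mx p 0); rewrite add_col_mx addr0.
  by apply; exists p => //; exists 0.
Qed.

(** The feedback [u = H v] keeps the first component inside the projection of a
    set that is invariant for the companion system. *)
Lemma companion_RPIS_implicit_RCIS C :
  is_RPIS F G W Sxv C -> is_implicit_RCIS A B E W Sxu C.
Proof.
move=> [CS Cinv]; split=> [_ [z Cz <-]|_ [z Cz <-]].
  exists (col_mx (usubmx z) (H *m dsubmx z)); first exact: CS.
  by rewrite col_mxKu.
exists (H *m dsubmx z); split; first exact: CS.
move=> _ [_ -> [_ [w Ww <-] <-]].
exists (F *m z + G *m w); first exact: Cinv.
by rewrite companion_stepE col_mxKu mulmxA.
Qed.

Section NilpotentPeriodic.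
Variables (nu tau lambda : nat).
Hypotheses (nu0 : (0 < nu)%N) (Anu : A ^+ nu = 0).
Hypothesis hP : eventually_periodic P tau lambda.

(** Past the nilpotency index the initial state is forgotten, as are all inputs
    and disturbances but the last [nu] ones. *)
Lemma safe_after_nilpotent t x v : (nu <= t)%N ->
  safe_after t x v =
  minkowski_diff Sxu (stacked_product (acc_disturbance_inf A E W nu) [set 0])
    (col_mx (\sum_(1 <= i < nu.+1) A ^+ i.-1 *m B *m H *m P ^+ (t - i) *m v)
            (H *m P ^+ t *m v)).
Proof.
move=> nut; have A0 s : (nu <= s)%N -> A ^+ s = 0.
  by move/subnKC <-; rewrite exprD Anu mul0r.
rewrite /safe_after /acc_disturbance_inf (acc_disturbance_nilpotent E W nu0 Anu) //.
rewrite (A0 _ nut) mul0mx add0r (@big_cat_nat _ _ _ nu.+1) //=.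
rewrite [X in _ + X]big1_seq ?addr0 // => i.
rewrite mem_index_iota => /andP[_ /andP[nui _]].
by rewrite A0 ?mul0mx // -ltnS prednK // (leq_trans _ nui).
Qed.

(** Only the exponents [t - nu], ..., [t] of [P] occur at time [t >= nu]; once
    [t - nu] exceeds the transient, the constraint is therefore periodic. *)
Lemma safe_after_periodic t x v : (nu + tau <= t)%N ->
  safe_after (t + lambda) x v = safe_after t x v.
Proof.
move=> ht; have nut : (nu <= t)%N := leq_trans (leq_addr _ _) ht.
rewrite !safe_after_nilpotent ?(leq_trans nut) ?leq_addr //.
rewrite hP ?(leq_trans (leq_addl nu tau)) //; congr (minkowski_diff _ _ (col_mx _ _)).
apply: eq_big_nat => i /andP[_ inu].
have it : (i <= t)%N by rewrite (leq_trans _ nut).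
rewrite -addnBAC // hP // leq_subRL //.
by rewrite (leq_trans _ ht) // leq_add2r.
Qed.

Lemma Cxv_safe_after (lambda0 : (0 < lambda)%N) z :
  Cxv A B E W Sxu P H nu tau lambda z <->
  forall t, safe_after t (usubmx z) (dsubmx z).
Proof.
split=> [[safe_lt safe_ge] t|safe_z].
  elim/ltn_ind: t => t IHt.
  have [tnu|nut] := ltnP t nu; first exact: safe_lt.
  have [tN|Nt] := ltnP t (nu + tau + lambda).
    by rewrite safe_after_nilpotent //; exact: safe_ge.
  have lt : (lambda <= t)%N := leq_trans (leq_addl _ _) Nt.
  rewrite -(subnK lt) safe_after_periodic; last by rewrite leq_subRL // addnC.
  by apply: IHt; rewrite -[ltnRHS]subn0 ltn_sub2l // (leq_trans lambda0).
split=> [t _|t nut _]; first exact: safe_z.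
by rewrite -(safe_after_nilpotent (usubmx z)) //; exact: safe_z.
Qed.

End NilpotentPeriodic.

End CompanionSystem.

(** * The finitely determined invariant set *)

Theorem theorem3p5 (R : realType) (n m d q nu tau lambda : nat)
    (A : 'M[R]_n) (B : 'M[R]_(n, m)) (E : 'M[R]_(n, d))
    (Sxu : set 'cV[R]_(n + m)) (W : set 'cV[R]_d)
    (P : 'M[R]_(m * q)) (H : 'M[R]_(m, m * q))
    (hA : nilpotency_index A nu)
    (hS : polytope Sxu) (hW : polytope W)
    (hq : (0 < q)%N) (hlambda : (0 < lambda)%N)
    (hP : eventually_periodic P tau lambda)
    (hH : surjective_mx H) :
  is_implicit_RCIS A B E W Sxu (Cxv A B E W Sxu P H nu tau lambda) /\
  is_maximal_RPIS (companion_mx A B P H) (companion_dist_mx (m * q) E) W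
    (companion_safe_set H Sxu)
    (Cxv A B E W Sxu P H nu tau lambda).
Proof.
have [nu0 Anu _] := hA.
have CxvE : Cxv A B E W Sxu P H nu tau lambda =
    robustly_safe_states (companion_mx A B P H) (companion_dist_mx (m * q) E) W
      (companion_safe_set H Sxu).
  apply/seteqP; split=> z.
    by move=> /(Cxv_safe_after B E H W Sxu nu0 Anu hP hlambda)
      /robustly_safe_companionE.
  by move=> /robustly_safe_companionE
    /(Cxv_safe_after B E H W Sxu nu0 Anu hP hlambda).
have Cmax := robustly_safe_states_maximal (companion_mx A B P H)
  (companion_dist_mx (m * q) E) W (companion_safe_set H Sxu).
rewrite CxvE; split=> //.
exact: companion_RPIS_implicit_RCIS Cmax.1.
Qed.
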